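(* For each positive integer $d\ge 1$ there exists a bipartite, connected, nontraceable detour graph with detour deficiency at least $d$.
   Context: All graphs are finite and simple; the order of a path is its number of vertices. For a vertex $v$, $\tau(v)$ is the order of a longest path in the graph having $v$ as an endvertex, and $\tau(G)$ is the order of a longest path in $G$. A detour graph is one in which all vertices have the same $\tau(v)$. Nontraceable means having no hamiltonian path. The detour deficiency of $G$ is $|V(G)|-\tau(G)$. *)

(* Defs.v *)
From mathcomp Require Import all_boot.
Set Implicit Arguments. Unset Strict Implicit. Unset Printing Implicit Defensive.

Definition simple_graph (T : finType) (e : rel T) : Prop :=
  symmetric e /\ irreflexive e.

Definition is_gpath (T : finType) (e : rel T) (p : seq T) : bool :=
  match p with
  | [::] => false
  | x :: s => path e x s && uniq p
  end.

Definition has_path_from (T : finType) (e : rel T) (v : T) (k : nat) : bool :=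
  [exists t : k.-tuple T, is_gpath e t && (head v t == v)].

Definition has_path (T : finType) (e : rel T) (k : nat) : bool :=
  [exists t : k.-tuple T, is_gpath e t].

(* tau(v): order of a longest path having v as an endvertex
   (paths have order <= #|T| since vertices are distinct) *)
Definition tau_v (T : finType) (e : rel T) (v : T) : nat :=
  \max_(k < #|T|.+1 | has_path_from e v k) k.

Definition tau_G (T : finType) (e : rel T) : nat :=
  \max_(k < #|T|.+1 | has_path e k) k.

Definition detour_graph (T : finType) (e : rel T) : Prop :=
  forall u v : T, tau_v e u = tau_v e v.

Definition bipartite (T : finType) (e : rel T) : Prop :=
  exists c : T -> bool, forall x y, e x y -> c x != c y.

Definition connected_graph (T : finType) (e : rel T) : Prop :=
  0 < #|T| /\ forall x y : T, connect e x y.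

Definition nontraceable (T : finType) (e : rel T) : Prop :=
  ~~ has_path e #|T|.

Definition detour_deficiency (T : finType) (e : rel T) : nat :=
  #|T| - tau_G e.

(* Main.v *)
Require Import Defs.
From mathcomp Require Import all_boot.
From mathcomp Require Import zify.
Set Implicit Arguments. Unset Strict Implicit. Unset Printing Implicit Defensive.

(** The gadget is a pair of 6-cycles, on levels [false] and [true] with positions 0..5,
    and rungs joining equal odd positions.  Positions 0 are its left ports and positions 4
    its right ports.  Put [d + 2] gadgets on a ring and join, on each level, the right port
    of each gadget to the left port of the next one through one extra vertex, a piece.

    Two disjoint paths from the left to the right ports of a gadget miss at least two of
    its vertices.  Hence, if a path visits both pieces between two consecutive gadgets and
    neither end of it is near, then it misses two vertices of one of these gadgets: otherwise
    it would join the two right ports of the first gadget inside that gadget, and the two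
    left ports of the second one inside the second, and close up to a cycle.  Each end of the
    path excuses at most one pair of pieces, so at least [d] vertices are missed altogether.

    Conversely, from any vertex of a gadget there is a path that covers this gadget in two
    visits, in between bounces on the previous gadget using both pieces there, then runs
    around the ring and ends by bouncing on that same previous gadget from its other side.
    It misses exactly one piece of all but two pairs. *)

(** * Crossings between a vertex set and its complement along a path *)

Section Cross.
Variables (T : eqType) (S : pred T).
Implicit Types (p u c w : seq T) (x y z : T).

(** A one-vertex run with outside vertices before and after it is listed twice, once for entering
    [S] and once for leaving. *)
Fixpoint cross p : seq T :=
  match p with
  | x :: q => if q is y :: _ then
      (if S x == S y then [::] else [:: if S x then x else y]) ++ cross q
      else [::]
  | [::] => [::]
  end.

Arguments cross : simpl never.

Lemma cross_cons2 x y p : cross [:: x, y & p] =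
  (if S x == S y then [::] else [:: if S x then x else y]) ++ cross (y :: p).
Proof. by []. Qed.

Lemma odd_cross x p : odd (size (cross (x :: p))) = S x (+) S (last x p).
Proof.
elim: p x => [|y p IH] x; first by rewrite /= addbb.
rewrite cross_cons2 size_cat oddD IH last_cons.
by case: (S x); case: (S y); case: (S _).
Qed.

Lemma mem_cross z p : z \in cross p -> (z \in p) && S z.
Proof.
elim: p => [|x [|y p] IH] //; rewrite cross_cons2 mem_cat => /orP[|/IH/andP[zp ->]].
  case: ifP=> // Sxy; rewrite inE; case: ifP => Sx /eqP ->; rewrite !inE eqxx ?orbT ?Sx //.
  by move: Sxy; rewrite Sx; case: (S y).
by rewrite inE zp orbT.
Qed.

Lemma cross_edge (e : rel T) x p z : symmetric e -> path e x p ->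
  z \in cross (x :: p) -> exists2 y, ~~ S y & e z y.
Proof.
move=> eC; elim: p x => [|y p IH] x // /andP[exy pth];
  rewrite cross_cons2 mem_cat => /orP[|/(IH _ pth)//].
case: ifP=> // Sxy; rewrite inE; case: ifP => Sx /eqP ->; first by exists y => //; move: Sxy;
  rewrite Sx; case: (S y).
by exists x; rewrite ?Sx // eC.
Qed.

(** On a path without repetitions only the vertex of a one-vertex run could be listed twice, and it
    would have two distinct neighbours outside [S]. *)
Lemma uniq_cross (e : rel T) x p : symmetric e ->
  (forall z y y', S z -> ~~ S y -> ~~ S y' -> e z y -> e z y' -> y = y') ->
  path e x p -> uniq (x :: p) -> uniq (cross (x :: p)).
Proof.
move=> eC out; elim: p x => [|y p IH] x // /andP[exy pth] /andP[xNp unq].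
rewrite cross_cons2; have := IH y pth unq; case: ifP=> //= /eqP Sxy ->; rewrite andbT.
case: ifP => Sx; first by apply: contra xNp => /mem_cross/andP[].
move: Sxy; rewrite Sx; case Sy: (S y) => // _.
case: p pth unq xNp {IH} => [|z p] //= /andP[eyz _] /andP[yNp _]; rewrite !inE !negb_or.
case/and3P=> _ xz _; rewrite cross_cons2 Sy mem_cat negb_or; apply/andP; split; last first.
  by apply: contra yNp => /mem_cross/andP[].
case Sz: (S z) => //=; rewrite inE eqxx /=.
by case/eqP: xz; apply: (out y) => //; rewrite ?Sx ?Sz // eC.
Qed.

Lemma cross_consec x y u w : S x != S y ->
  (if S x then x else y) \in cross (u ++ x :: y :: w).
Proof.
move=> Sxy; elim: u => [|z u IH]; first by rewrite cross_cons2 (negPf Sxy) inE eqxx.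
by case: u IH => [|z' u] IH; rewrite ?cat_cons cross_cons2 mem_cat IH orbT.
Qed.

Lemma cross_all x c : all S (x :: c) -> cross (x :: c) = [::].
Proof.
elim: c x => [|y c IH] x // /andP[Sx Sc]; rewrite cross_cons2 IH //.
by case/andP: Sc => Sy _; rewrite Sx Sy.
Qed.

Lemma cross_none p : ~~ has S p -> cross p = [::].
Proof.
elim: p => [|x [|y p] IH] // H; rewrite cross_cons2 IH; last by case/norP: H.
by case/norP: H => /negPf -> /norP[/negPf ->].
Qed.

Lemma cross_cat u x w : cross (rcons u x ++ w) = cross (rcons u x) ++ cross (x :: w).
Proof.
elim: u => [|y u IH]; first by case: w.
by case: u IH => [|z u] IH; rewrite /= !cross_cons2 -catA -IH.
Qed.

(** Used together with [first_run] to peel off maximal runs one by one, which computes [cross] as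
    the list of the ends of all runs. *)
Lemma cross_run u x c (w0 : T) w : ~~ has S u -> u != [::] -> all S (x :: c) -> ~~ S w0 ->
  cross (u ++ (x :: c) ++ w0 :: w) = [:: x, last x c & cross (w0 :: w)].
Proof.
case/lastP: u => // u y Hu _ Hc Hw; rewrite cross_cat (cross_none Hu) cat0s cat_cons cross_cons2.
have Sx : S x by case/andP: Hc.
have Sy : ~~ S y by move: Hu; rewrite has_rcons => /norP[].
rewrite (negPf Sy) Sx; congr cons.
rewrite -cat_cons lastI cross_cat -lastI (cross_all Hc) cat0s cross_cons2.
have -> : S (last x c) by apply: (allP Hc); apply: mem_last.
by rewrite (negPf Hw).
Qed.

Lemma has_split (a : pred T) p : has a p ->
  exists u y q, [/\ p = u ++ y :: q, a y & ~~ has a u].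
Proof. by case/split_find => y u q ay Hu; exists u, y, q; rewrite cat_rcons. Qed.

Lemma first_run x p : ~~ S x -> ~~ S (last x p) ->
  ~~ has S (x :: p) \/
  exists u y c (w0 : T) w, [/\ x :: p = u ++ (y :: c) ++ w0 :: w, ~~ has S u, u != [::],
    all S (y :: c) & ~~ S w0].
Proof.
move=> Sx Sl; case H: (has S (x :: p)); last by left.
right; case/has_split: (H) => u [y [q [defp Sy Hu]]].
have Sq : has (predC S) (y :: q).
  apply/hasP; exists (last x p) => //.
  have -> : last x p = last x (x :: p) by [].
  by rewrite defp last_cat /= mem_last.
case/has_split: Sq => c [w0 [w [defq Sw0 Hc]]].
have {}Hc : all S c by rewrite -[all S c]negbK -has_predC.
case: c Hc defq => [|y' c] Hc []; first by move=> y0; rewrite /= -y0 Sy in Sw0.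
move=> yy' defq; rewrite -{}yy' in Hc.
exists u, y, c, w0, w; split=> //; first by rewrite defp defq.
by apply/eqP => u0; rewrite u0 /= in defp; case: defp Sx Sy => <- _ /negP.
Qed.

Lemma consec_interior x p z : z \in x :: p -> z != x -> z != last x p ->
  exists u a b w, x :: p = u ++ [:: a, z, b & w].
Proof.
move=> zp zx zl; have [u [w defp]] : exists u w, x :: p = u ++ z :: w.
  by case/splitPr: zp => u w; exists u, w.
move: defp.
case/lastP: u => [|u a] /= defp; first by case: defp zx => ->; rewrite eqxx.
case: w defp => [|b w] defp; last by exists u, a, b, w; rewrite defp cat_rcons.
have : last x (x :: p) = z by rewrite defp last_cat.
by move=> /= E; rewrite E eqxx in zl.
Qed.

End Cross.

(** * Exhaustive search over the paths of a finite graph *)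

Section AllPaths.
Variables (T : eqType) (e : rel T) (dom : seq T) (K : seq T -> T -> bool).

(* [if] rather than [&&], [||] and [==>]: a call-by-value reduction would evaluate
   both arguments of the latter and not prune the search. *)
Fixpoint all_paths (k : nat) (vis : seq T) (x : T) : bool :=
  if x \in vis then true else if K (x :: vis) x then
    if k is k'.+1 then all (fun y => if e x y then all_paths k' (x :: vis) y else true) dom
    else false
  else false.

(** Running out of fuel at an unvisited vertex yields [false], so a successful search has inspected
    every path. Visited vertices pile up in reverse order on [vis], hence [catrev]. *)
Lemma all_pathsP k vis x s : all_paths k vis x -> path e x s ->
  uniq (x :: s) -> {in x :: s, forall z, z \notin vis} -> {subset s <= dom} ->
  K (catrev (x :: s) vis) (last x s).
Proof.
elim: k vis x s => [|k IH] vis x s /=.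
  by case: ifP => [xv _ _ _ /(_ x (mem_head _ _))|]; [rewrite xv | case: ifP].
case: ifP => [xv _ _ _ /(_ x (mem_head _ _))|_]; first by rewrite xv.
case: ifP => // Kx H.
case: s => [|y s] //= /andP[xy pth] /andP[xs ys] Hv sub.
have := allP H y (sub _ (mem_head _ _)); rewrite xy /= => Hy; apply: (IH _ _ _ Hy) => //.
  move=> z zys /=; rewrite inE negb_or; apply/andP; split.
    by apply: contraNneq xs => <-.
  by apply: Hv; rewrite inE zys orbT.
by move=> z zs; apply: sub; rewrite inE zs orbT.
Qed.

End AllPaths.

(** * The gadget *)

(* A label is a level and a position; position 6 is the piece following the gadget. *)
Notation label := (bool * nat)%type.

(** All pairs but the last form the 6-cycle; [(4,6)] attaches the piece to the right port. *)
Definition hexn (j k : nat) : bool :=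
  (j, k) \in [:: (0,1); (1,2); (2,3); (3,4); (4,5); (0,5); (4,6)].

Definition ladj : rel label := fun x y =>
  if x.1 == y.1 then hexn x.2 y.2 || hexn y.2 x.2 else (x.2 == y.2) && odd x.2.

Lemma ladjC : symmetric ladj.
Proof.
move=> [a i] [b j]; rewrite /ladj /= eq_sym orbC [i == j]eq_sym.
by case: eqP=> // _; case: eqP=> // ->.
Qed.

Definition labels : seq label := [seq (s, j) | s <- [:: false; true], j <- iota 0 6].

(** For each path from one left port to a right port, the inner search runs over all paths from the
    other left port that avoid it. Fuel 13 suffices because [labels] has 12 elements. *)
Lemma crossing_cover s :
  all_paths ladj labels (fun vis y => if y.2 == 4 then
      all_paths ladj labels (fun vis' z => if z.2 == 4 then size vis' <= 10 else true)
        13 vis (~~ s, 0) else true)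
    13 [::] (s, 0).
Proof. by case: s; vm_compute. Qed.

Lemma crossing_paths s t c d : path ladj (s, 0) c -> path ladj (t, 0) d ->
  t != s -> (last (s, 0) c).2 = 4 -> (last (t, 0) d).2 = 4 ->
  uniq ((s, 0) :: c ++ (t, 0) :: d) -> {subset c ++ d <= labels} ->
  size c + size d <= 8.
Proof.
move=> pc pd ts lc ld; rewrite -cat_cons cat_uniq => /and3P[uc Hcd ud] sub.
have {ts}t_s : t = ~~ s by case: (t) (s) ts => [] [].
have H1 := all_pathsP (crossing_cover s) pc uc; rewrite lc eqxx -t_s in H1.
have sc : {subset c <= labels} by move=> z zc; apply: sub; rewrite mem_cat zc.
have := all_pathsP (H1 (fun _ _ => isT) sc) pd ud; rewrite ld eqxx => {}H2.
have : size (catrev ((t, 0) :: d) (catrev ((s, 0) :: c) [::])) <= 10.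
  apply: H2 => z zd; last by apply: sub; rewrite mem_cat zd orbT.
  by rewrite catrevE cats0 mem_rev; apply: contra Hcd => zc; apply/hasP; exists z.
by rewrite !catrevE cats0 size_cat !size_rev /=; lia.
Qed.

(** * How runs can pair up the four ports of a gadget *)

Notation sides := [:: 0; 4].

Definition same_side (j : nat) (a b : label) := [&& a.2 == j, b.2 == j & b.1 != a.1].

Lemma one_run_sides (a b : label) j : a.2 \in sides -> b.2 \in sides -> j \in sides ->
  uniq [:: a; b] -> (false, j) \in [:: a; b] -> (true, j) \in [:: a; b] -> same_side j a b.
Proof.
case: a b => [s1 k1] [s2 k2]; rewrite /same_side !inE /=.
do 3?[move=> /orP[]/eqP ->]; by case: s1; case: s2.
Qed.

(** Four distinct ports are all of them. If one run joins the two ports of a side, the other run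
    joins those of the opposite side, and one of these sides is [j]; otherwise both runs go
    across. *)
Lemma two_runs_sides (a b c d : label) j :
  a.2 \in sides -> b.2 \in sides -> c.2 \in sides -> d.2 \in sides -> j \in sides ->
  uniq [:: a; b; c; d] -> (false, j) \in [:: a; b; c; d] -> (true, j) \in [:: a; b; c; d] ->
  [|| same_side j a b, same_side j c d | (a.2 != b.2) && (c.2 != d.2)].
Proof.
case: a b c d => [s1 k1] [s2 k2] [s3 k3] [s4 k4]; rewrite /same_side !inE /=.
do 5?[move=> /orP[]/eqP ->]; by case: s1; case: s2; case: s3; case: s4.
Qed.

(** * The ring of gadgets, and the upper bound *)

Section Ring.
Variable n : nat.
Notation r := n.+2.
Definition vtx : finType := ('I_r * (bool * 'I_7))%type.
Implicit Types (x y z : vtx) (i : 'I_r).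

Definition lab x : label := (x.2.1, val x.2.2).
Definition emb i (l : label) : vtx := (i, (l.1, inord l.2)).

Definition link x y : bool :=
  [&& y.1 == ordS x.1, x.2.1 == y.2.1, (lab x).2 == 6 & (lab y).2 == 0].

Definition edge : rel vtx := fun x y =>
  [|| (x.1 == y.1) && ladj (lab x) (lab y), link x y | link y x].

Lemma edgeC : symmetric edge.
Proof. by move=> x y; rewrite /edge eq_sym ladjC [link x y || _]orbC. Qed.

Lemma emb_lab x : emb x.1 (lab x) = x.
Proof. by case: x => i [s j]; rewrite /emb /lab /= inord_val. Qed.

Lemma lab_emb i s j : j < 7 -> lab (emb i (s, j)) = (s, j).
Proof. by move=> j7; rewrite /lab /= inordK. Qed.

Lemma lab_lt7 x : (lab x).2 < 7.
Proof. exact: ltn_ord. Qed.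

Lemma vtx_eq x y : x.1 = y.1 -> lab x = lab y -> x = y.
Proof. by move=> E1 E2; rewrite -(emb_lab x) -(emb_lab y) E1 E2. Qed.

Definition core i : pred vtx := fun x => (x.1 == i) && ((lab x).2 < 6).

(** The unique outside neighbour of a port of gadget [i]; for a left port it is a piece indexed by
    the previous gadget. *)
Definition outer i s j : vtx := emb (if j == 0 then ord_pred i else i) (s, 6).

Lemma ladj_exit l s : ladj l (s, 6) -> l = (s, 4).
Proof.
case: l => t j; rewrite /ladj; case: eqP => /= [->|_ /andP[/eqP->]//].
by rewrite /hexn !inE !xpair_eqE /= !andbF /= andbT orbF => /eqP ->.
Qed.

Lemma edge_outer i x y : core i x -> ~~ core i y -> edge x y ->
  exists2 j, j \in [:: 0; 4] & lab x = (x.2.1, j) /\ y = outer i x.2.1 j.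
Proof.
move=> /andP[/eqP xi x6] Ny /or3P[/andP[/eqP xy adj]|/and4P[_ _ /eqP x6' _]|/and4P[/eqP xSy
  /eqP sy /eqP y6 /eqP x0]].
- move: Ny; rewrite /core -xy xi eqxx -leqNgt => /= y6.
  have {}y6 : (lab y).2 = 6 by apply/eqP; rewrite eqn_leq y6 andbT -ltnS lab_lt7.
  have E : lab y = ((lab y).1, 6) by rewrite -y6; case: (lab y).
  rewrite E in adj; have E' := ladj_exit adj;
    have E1 : x.2.1 = (lab y).1 by rewrite -[x.2.1]/((lab x).1) E'.
  exists 4; [by [] | split]; first by rewrite E' E1.
  by rewrite E1; apply: vtx_eq; rewrite /= -?xy ?xi // lab_emb // E.
- by rewrite x6' in x6.
- exists 0 => //; split; first by rewrite [LHS]surjective_pairing x0.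
  apply: vtx_eq => /=; first by rewrite -xi xSy ordSK.
  by rewrite lab_emb // /lab /= -sy; congr pair.
Qed.

Lemma edge_outer_uniq i z y y' : core i z -> ~~ core i y -> ~~ core i y' ->
  edge z y -> edge z y' -> y = y'.
Proof.
move=> Sz Sy Sy' /(edge_outer Sz Sy)[j _ [zj ->]] /(edge_outer Sz Sy')[j' _ [zj' ->]].
by rewrite zj' in zj; case: zj => ->.
Qed.

Lemma edge_piece i s y : edge (emb i (s, 6)) y -> y = emb i (s, 4) \/ y = emb (ordS i) (s, 0).
Proof.
case/or3P => [/andP[/eqP iy]|/and4P[/eqP yi /eqP sy _ /eqP y0]|/and4P[_ _ _]];
  rewrite ?lab_emb //.
  by rewrite ladjC => /ladj_exit ly; left; apply: vtx_eq; rewrite ?lab_emb.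
right; apply: vtx_eq; rewrite ?lab_emb //= -?yi //.
by rewrite -y0; move: sy; rewrite /= => ->; case: (y) => [? []].
Qed.

(** * How one fixed path meets the gadgets *)

Section Path.
Variables (h : vtx) (q : seq vtx).
Hypotheses (pth : path edge h q) (unq : uniq (h :: q)).
Notation p := (h :: q).
Notation l := (last h q).

Definition full i : bool := [forall s : bool,
  [&& emb i (s, 6) \in p, emb i (s, 6) != h & emb i (s, 6) != l]].

(** A piece has only two neighbours, the ports facing it in gadgets [i] and [ordS i]; as an interior
    vertex of the path it uses both. *)
Lemma full_cross i : full i -> forall s,
  emb i (s, 4) \in cross (core i) p /\ emb (ordS i) (s, 0) \in cross (core (ordS i)) p.
Proof.
move=> /forallP fi s; case/and3P: (fi s) => zp zh zl.
have [u [a [b [w defp]]]] := consec_interior zp zh zl.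
have Nz k : ~~ core k (emb i (s, 6)) by rewrite /core lab_emb // andbF.
have C4 : core i (emb i (s, 4)) by rewrite /core lab_emb // eqxx.
have C0 : core (ordS i) (emb (ordS i) (s, 0)) by rewrite /core lab_emb // eqxx.
have H c d : core c d -> (d == a) || (d == b) -> d \in cross (core c) p.
  rewrite defp => cd /orP[]/eqP ?; subst d.
    by have := @cross_consec _ (core c) a (emb i (s,6)) u (b :: w);
      rewrite cd (negPf (Nz c)) => ->.
  have := @cross_consec _ (core c) (emb i (s,6)) b (rcons u a) w;
    rewrite cat_rcons cd (negPf (Nz c)); exact.
have Sp : sorted edge p by [].
move: (Sp) (unq); rewrite defp cat_uniq => /cat_sorted2[_] /= /and3P[az zb _] /and3P[_ _].
rewrite !inE !negb_or => /andP[/and3P[_ ab _] _].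
rewrite edgeC in az.
case: (edge_piece az) (edge_piece zb) => Ea [] Eb; rewrite -?defp.
- by rewrite Ea Eb eqxx in ab.
- by split; apply: H; rewrite // ?Ea ?Eb eqxx ?orbT.
- by split; apply: H; rewrite // ?Ea ?Eb eqxx ?orbT.
- by rewrite Ea Eb eqxx in ab.
Qed.

Lemma outer_eq i s j y : j \in [:: 0; 4] -> ~~ core i y -> edge (emb i (s, j)) y ->
  y = outer i s j.
Proof.
move=> j04 Ny; have j6 : j < 6 by move: j04; rewrite !inE => /orP[]/eqP ->.
have Sx : core i (emb i (s, j)) by rewrite /core lab_emb ?eqxx //; lia.
move=> /(edge_outer Sx Ny)[j' _ []]; rewrite lab_emb; last by lia.
by move=> [<-] ->.
Qed.

Lemma cross_port i z : z \in cross (core i) p ->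
  exists s j, j \in [:: 0; 4] /\ z = emb i (s, j).
Proof.
move=> zc; have /andP[_ Sz] := mem_cross zc.
have [y Ny /(edge_outer Sz Ny)[j j04 [zj _]]] := cross_edge edgeC pth zc.
exists z.2.1, j; split=> //; case/andP: Sz => /eqP <- _.
by rewrite -zj emb_lab.
Qed.

(** A bounce on side [j] of gadget [i], from one piece to the other; [s] records its direction. *)
Definition chunk i j := exists s u c w,
  [/\ p = u ++ outer i s j :: c ++ outer i (~~ s) j :: w, c != [::] & all (core i) c].

Lemma run_chunk i j s u a y c w0 w : p = rcons u a ++ (y :: c) ++ w0 :: w ->
  ~~ core i a -> ~~ core i w0 -> all (core i) (y :: c) -> j \in [:: 0; 4] ->
  y = emb i (s, j) -> last y c = emb i (~~ s, j) -> chunk i j.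
Proof.
move=> defp Sa Sw Sc j04 Ey El; have Sp : sorted edge p by [].
move: Sp; rewrite defp cat_rcons => /cat_sorted2[_] /=.
rewrite cat_path /= => /and4P[ay _ lw _].
rewrite edgeC Ey in ay; rewrite El in lw.
exists s, u, (y :: c), w; split=> //.
by rewrite defp cat_rcons -(outer_eq j04 Sa ay) -(outer_eq j04 Sw lw).
Qed.

Lemma run_labels i y c : path edge y c -> all (core i) (y :: c) ->
  path ladj (lab y) (map lab c) /\ {subset map lab (y :: c) <= labels}.
Proof.
move=> pc Sc; split.
  elim: c y pc Sc => [|z c IH] y //= /andP[yz pc] /and3P[Sy Sz Sc].
  rewrite IH ?andbT //= ?Sz //; case/andP: Sy Sz => /eqP yi y6 /andP[/eqP zi z6].
  by case/or3P: yz => [/andP[]//|/and4P[_ _ /eqP y6' _]|/and4P[_ _ /eqP z6' _]];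
    [rewrite y6' in y6 | rewrite z6' in z6].
move=> b /mapP[z /(allP Sc)/andP[_ z6] ->].
by case: (lab z) z6 => [[] j] /=; do 6?[case: j => [|j] //].
Qed.

(** Prepares for [crossing_paths], whose paths start at position 0: a run entering at position 4 is
    reversed. Only the set of its vertices matters afterwards, hence [perm_eq]. *)
Lemma run_orient i y c s1 s2 j1 j2 : path edge y c -> all (core i) (y :: c) ->
  y = emb i (s1, j1) -> last y c = emb i (s2, j2) ->
  j1 \in [:: 0; 4] -> j2 \in [:: 0; 4] -> j1 != j2 ->
  exists s d, [/\ path ladj (s, 0) d, (last (s, 0) d).2 = 4 &
    perm_eq ((s, 0) :: d) (map lab (y :: c))].
Proof.
move=> pc Sc Ey El j1P j2P j12; have [pl _] := run_labels pc Sc.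
have ly : lab y = (s1, j1) by rewrite Ey lab_emb //; move: j1P; rewrite !inE => /orP[]/eqP ->.
have ll : last (lab y) (map lab c) = (s2, j2).
  by rewrite last_map El lab_emb //; move: j2P; rewrite !inE => /orP[]/eqP ->.
rewrite /= ly; rewrite ly in pl ll.
move: j1P j2P j12; rewrite !inE => /orP[]/eqP E1 /orP[]/eqP E2; subst j1 j2 => // _.
  by exists s1, (map lab c); rewrite ll.
exists s2, (rev (belast (s1, 4) (map lab c))).
rewrite -ll rev_path (@eq_path _ _ ladj) => [|a b]; last exact: ladjC.
split=> //; first by case: (map lab c) => [|b d] //=; rewrite rev_cons last_rcons.
by rewrite -rev_rcons -lastI perm_rev.
Qed.

Lemma two_runs i y c z d s1 s2 s3 s4 j1 j2 j3 j4 :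
  path edge y c -> all (core i) (y :: c) -> path edge z d -> all (core i) (z :: d) ->
  uniq ((y :: c) ++ (z :: d)) ->
  y = emb i (s1, j1) -> last y c = emb i (s2, j2) ->
  j1 \in [:: 0; 4] -> j2 \in [:: 0; 4] -> j1 != j2 ->
  z = emb i (s3, j3) -> last z d = emb i (s4, j4) ->
  j3 \in [:: 0; 4] -> j4 \in [:: 0; 4] -> j3 != j4 ->
  size (y :: c) + size (z :: d) <= 10.
Proof.
move=> pc Sc pd Sd U Ey Ely j1P j2P j12 Ez Elz j3P j4P j34.
have [s [c' [pc' lc' permc]]] := run_orient pc Sc Ey Ely j1P j2P j12.
have [t [d' [pd' ld' permd]]] := run_orient pd Sd Ez Elz j3P j4P j34.
have [_ subc] := run_labels pc Sc; have [_ subd] := run_labels pd Sd.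
have permcd : perm_eq (((s, 0) :: c') ++ ((t, 0) :: d')) (map lab ((y :: c) ++ (z :: d))).
  by rewrite map_cat; apply: perm_cat.
have U' : uniq (((s, 0) :: c') ++ ((t, 0) :: d')).
  rewrite (perm_uniq permcd) map_inj_in_uniq // => a b.
  rewrite !mem_cat => Ha Hb; apply: vtx_eq.
  have Hi x : (x \in y :: c) || (x \in z :: d) -> x.1 = i.
    by case/orP => [/(allP Sc)|/(allP Sd)] /andP[/eqP].
  by rewrite (Hi _ Ha) (Hi _ Hb).
have := crossing_paths pc' pd' _ lc' ld' U' _.
have -> : size (y :: c) = (size c').+1 by rewrite -(size_map lab (y :: c)) -(perm_size permc).
have -> : size (z :: d) = (size d').+1 by rewrite -(size_map lab (z :: d)) -(perm_size permd).
move=> H; rewrite addSn addnS !ltnS.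
apply: H; first by move: U'; apply: contraTneq => ->; rewrite cat_uniq /= inE eqxx ?orbT ?andbF.
move=> b; rewrite mem_cat => /orP[bc|bd].
  by apply: subc; rewrite -(perm_mem permc) inE bc orbT.
by apply: subd; rewrite -(perm_mem permd) inE bd orbT.
Qed.

(** The ends of the runs inside the gadget are distinct ports, so there are at most two runs. Either
    one of them joins the two ports of side [j], or two runs cross the gadget and [two_runs]
    applies. *)
Lemma core_runs i j : j \in sides -> ~~ core i h -> ~~ core i l ->
  (forall s, emb i (s, j) \in cross (core i) p) ->
  count (core i) p <= 10 \/ chunk i j.
Proof.
move=> jP Sh Sl used; have Sp : sorted edge p by [].
pose X := cross (core i) p.
have UX : uniq X by apply: uniq_cross pth unq; [exact: edgeC | exact: edge_outer_uniq].
have Xemb : {in X, forall z, (lab z).2 \in sides /\ z = emb i (lab z)}.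
  move=> z /cross_port[s [k [kP ->]]].
  by rewrite lab_emb //; move: kP; rewrite !inE => /orP[]/eqP ->.
have UL : uniq (map lab X).
  by rewrite map_inj_in_uniq // => a b /Xemb[_ Ea] /Xemb[_ Eb] E; rewrite Ea Eb E.
have LX s : (s, j) \in map lab X.
  have <- : lab (emb i (s, j)) = (s, j).
    by rewrite lab_emb //; move: jP; rewrite !inE => /orP[]/eqP ->.
  by apply: map_f; apply: used.
have {used} run u a y c w0 w : p = rcons u a ++ (y :: c) ++ w0 :: w ->
    ~~ core i a -> ~~ core i w0 -> all (core i) (y :: c) -> y \in X -> last y c \in X ->
    same_side j (lab y) (lab (last y c)) -> chunk i j.
  move=> defp Sa Sw Sc /Xemb[_ Ey] /Xemb[_ El] /and3P[/eqP Ej /eqP Ej' ne].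
  apply: (run_chunk defp Sa Sw Sc jP (s := (lab y).1)).
    by rewrite {1}Ey -Ej -surjective_pairing.
  by rewrite {1}El -Ej' [lab (last y c)]surjective_pairing; congr (emb i (_, _));
    case: (lab _).1 ne; case: (lab _).1.
have rc u : u != [::] -> ~~ has (core i) u -> exists v a, u = rcons v a /\ ~~ core i a.
  by case/lastP: u => // v a _; rewrite has_rcons => /norP[Na _]; exists v, a.
case: (first_run Sh Sl) => [N|[u1 [y1 [c1 [w1 [q1 [E1 N1 u1N S1 Sw1]]]]]]].
  by have := LX true; rewrite /X cross_none.
have X1 := cross_run q1 N1 u1N S1 Sw1.
have Sl1 : ~~ core i (last w1 q1).
  by have := Sl; rewrite -[l]/(last h p) E1 !last_cat.
have [v1 [a1 [Eu1 Sa1]]] := rc _ u1N N1.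
have pc1 : path edge y1 c1.
  by move: Sp; rewrite E1 => /cat_sorted2[_ /cat_sorted2[]].
case: (first_run Sw1 Sl1) => [N|[u2 [y2 [c2 [w2 [q2 [E2 N2 u2N S2 Sw2]]]]]]].
  (* A single run must have the two ports of side [j] as its ends. *)
  have EX : X = [:: y1; last y1 c1] by rewrite /X E1 X1 (cross_none N).
  right; apply: (run v1 a1 y1 c1 w1 q1); rewrite -?Eu1 // ?EX ?inE ?eqxx ?orbT //.
  move: UL (LX true) (LX false); rewrite EX => U1 L1 L2.
  by apply: one_run_sides U1 L2 L1 => //; apply: (Xemb _ _).1; rewrite EX !inE eqxx ?orbT.
have X2 := cross_run q2 N2 u2N S2 Sw2.
have Sl2 : ~~ core i (last w2 q2).
  by have := Sl1; rewrite -[last w1 q1]/(last w1 (w1 :: q1)) E2 !last_cat.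
have [v2 [a2 [Eu2 Sa2]]] := rc _ u2N N2.
have pc2 : path edge y2 c2.
  by move: Sp; rewrite E1 E2 => /cat_sorted2[_ /cat_sorted2[_ /cat_sorted2[_ /cat_sorted2[]]]].
(* A third run would require at least six distinct ports. *)
case: (first_run Sw2 Sl2) => [N|[u3 [y3 [c3 [w3 [q3 [E3 N3 u3N S3 Sw3]]]]]]]; last first.
  have X3 := cross_run q3 N3 u3N S3 Sw3.
  have : size (map lab X) <= size [seq (s, k) | s <- [:: false; true], k <- sides].
    apply: uniq_leq_size => // b /mapP[z /Xemb[z2 _] ->].
    by rewrite [lab z]surjective_pairing; apply: allpairs_f => //; case: (lab z).1.
  by rewrite size_map /X E1 X1 E2 X2 E3 X3.
have EX : X = [:: y1; last y1 c1; y2; last y2 c2] by rewrite /X E1 X1 E2 X2 (cross_none N).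
have X2P z : z \in [:: y1; last y1 c1; y2; last y2 c2] -> (lab z).2 \in sides.
  by rewrite -EX => /Xemb[].
rewrite EX in UL LX.
have mem4 k : nth y1 [:: y1; last y1 c1; y2; last y2 c2] k \in [:: y1; last y1 c1; y2;
  last y2 c2].
  by case: k => [|[|[|[|k]]]]; rewrite /= ?inE ?eqxx ?orbT // nth_nil eqxx.
have := two_runs_sides (X2P _ (mem4 0)) (X2P _ (mem4 1)) (X2P _ (mem4 2)) (X2P _ (mem4 3)) jP
  UL (LX false) (LX true).
rewrite EX in run; case/or3P => [same|same|/andP[ne1 ne2]].
- by right; apply: (run v1 a1 y1 c1 w1 q1); rewrite -?Eu1 ?(mem4 0) ?(mem4 1).
- right; apply: (run (u1 ++ (y1 :: c1) ++ v2) a2 y2 c2 w2 q2); rewrite ?(mem4 2) ?(mem4 3) //.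
  by rewrite E1 E2 Eu2 -!cats1 -!catA.
left; move: Xemb; rewrite -/X EX => Xemb; have [s1 e1] := Xemb _ (mem4 0);
  have [s2 e2] := Xemb _ (mem4 1).
have [s3 e3] := Xemb _ (mem4 2); have [s4 e4] := Xemb _ (mem4 3).
have N0 v : ~~ has (core i) v -> count (core i) v = 0 by rewrite has_count -leqNgt leqn0 => /eqP.
rewrite E1 E2 !count_cat (N0 _ N1) (N0 _ N2) (N0 _ N) !add0n addn0.
have /eqP -> : count (core i) (y1 :: c1) == size (y1 :: c1) by rewrite -all_count.
have /eqP -> : count (core i) (y2 :: c2) == size (y2 :: c2) by rewrite -all_count.
apply: (two_runs pc1 S1 pc2 S2 _ (s1 := (lab y1).1) (s2 := (lab (last y1 c1)).1)
  (s3 := (lab y2).1) (s4 := (lab (last y2 c2)).1) _ _ s1 s2 ne1 _ _ s3 s4 ne2).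
- have := unq; rewrite E1 E2 !cat_uniq => /and3P[_ _ /and3P[-> ]].
  rewrite has_cat has_cat !negb_or => /and3P[_ H _] /and3P[_ _ /and3P[-> _ _]].
  by rewrite H.
- by rewrite -surjective_pairing.
- by rewrite -surjective_pairing.
- by rewrite -surjective_pairing.
- by rewrite -surjective_pairing.
Qed.

(** All four ports are crossings, and no other vertex is, so the number of crossings is even. *)
Lemma full_parity i : full (ord_pred i) -> full i -> core i h = core i l.
Proof.
move=> f0 f4; have UX : uniq (cross (core i) p).
  by apply: uniq_cross pth unq; [exact: edgeC | exact: edge_outer_uniq].
have sz : size (cross (core i) p) = 4.
  rewrite -[4]/(size (map (emb i) [seq (s, k) | s <- [:: false; true], k <- sides])).
  apply/eqP; rewrite -(uniq_size_uniq _) // => [|z].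
    by rewrite map_inj_in_uniq // => a b /allpairsP[[s k] [_ k1 ->]] /allpairsP[[t k'] [_ k1'
      ->]] /(congr1 lab);
      rewrite !lab_emb //=; [move: k1' | move: k1]; rewrite !inE => /orP[]/eqP /= ->.
  apply/idP/idP => [/mapP[_ /allpairsP[[s k] [_ kP ->]] ->]|/cross_port[s [k [kP ->]]]];
    last first.
    by apply: map_f; apply: allpairs_f => //; case: (s).
  move: kP; rewrite !inE /= => /orP[]/eqP ->.
    by have := (full_cross f0 s).2; rewrite ord_predK.
  exact: (full_cross f4 s).1.
by have := odd_cross (core i) h q; rewrite sz /=; case: (core i h); case: (core i _).
Qed.

Lemma index_chunk u x y c z w : p = u ++ x :: (y :: c) ++ z :: w ->
  index x p < index z p /\ nth h p (index x p).+1 = y.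
Proof.
move=> defp; have := unq; rewrite defp; rewrite cat_uniq => /and3P[_ /norP[xu /norP[_ Hu]]].
move=> U; have zu : z \notin u by apply: contra Hu => zu; apply/hasP; exists z;
  rewrite // mem_cat mem_head orbT.
have xz : x != z by case/andP: U => + _; rewrite mem_cat !inE !negb_or => /andP[_ /andP[]].
rewrite !index_cat (negPf xu) (negPf zu) /= eqxx (negPf xz) addn0; split; first by lia.
by rewrite nth_cat ltnNge leqnSn /= subSnn.
Qed.

Lemma full_loop i : full i -> ~~ core i h -> ~~ core i l ->
  ~~ core (ordS i) h -> ~~ core (ordS i) l ->
  (count (core i) p <= 10) || (count (core (ordS i)) p <= 10).
Proof.
move=> fi Sh Sl Sh' Sl'.
have [->//|] := core_runs (j := 4) isT Sh Sl (fun s => (full_cross fi s).1).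
have [->|] := core_runs (j := 0) isT Sh' Sl' (fun s => (full_cross fi s).2);
  first by rewrite orbT.
rewrite /chunk /outer /= ordSK.
move=> [s [u [[|y c] [w [E // _ /andP[/andP[/eqP yi _] _]]]]]].
move=> [t [u' [[|z d] [w' [E' // _ /andP[/andP[/eqP zi _] _]]]]]].
have [lt1 n1] := index_chunk E; have [lt2 n2] := index_chunk E'.
(* Bounces in opposite directions would put each of the two pieces before the other. *)
have ts : t = s.
  case: (eqVneq t s) => // ts; have {}ts : t = ~~ s by case: (t) (s) ts => [] [].
  by move: lt1 lt2; rewrite ts negbK => lt1 /ltn_trans/(_ lt1); rewrite ltnn.
(* For bounces in the same direction, the vertex following the first piece would lie in both
   gadgets, which are distinct since the ring has at least two. *)
move: n2; rewrite ts n1 => yz; move: yi; rewrite yz zi => /(congr1 val) /=.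
by have := ltn_ord i; rewrite leq_eqVlt => /orP[/eqP [->]|lt]; rewrite ?modnn // modn_small //;
  lia.
Qed.

(** * Counting the vertices missed by a path *)

Definition piece i : pred vtx := fun x => (x.1 == i) && ((lab x).2 == 6).

Lemma size_sum (a : seq vtx) : size a = \sum_i (count (core i) a + count (piece i) a).
Proof.
elim: a => [|x a IH]; first by rewrite big1.
rewrite /= {}IH -[LHS]add1n; under [RHS]eq_bigr do rewrite addnACA.
rewrite [RHS]big_split /=; congr addn.
rewrite (bigD1 x.1) //= big1 ?addn0 => [|i xi]; last by rewrite /core /piece eq_sym (negPf xi).
have := lab_lt7 x; rewrite /core /piece eqxx !andTb; case: (lab x) => _ /= k.
by do 7?[case: k => [|k] //].
Qed.

Lemma count_sub (a : pred vtx) (L : seq vtx) : {in p, forall x, a x -> x \in L} -> count a p <=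
  size L.
Proof.
move=> sub; rewrite -size_filter; apply: uniq_leq_size; first exact: filter_uniq.
by move=> x; rewrite mem_filter => /andP[ax xp]; apply: sub.
Qed.

Lemma count_core i : count (core i) p <= 12.
Proof.
apply: (count_sub (L := map (emb i) labels)) => x _ /andP[/eqP <- x6].
rewrite -{1}(emb_lab x); apply: map_f.
by case: (lab x) x6 => [[] j] /=; do 6?[case: j => [|j] //].
Qed.

Lemma count_piece i : count (piece i) p <= 2.
Proof.
apply: (count_sub (L := [:: emb i (false, 6); emb i (true, 6)])) => x _ /andP[/eqP <- /eqP x6].
by rewrite -{1 3}(emb_lab x) [lab x]surjective_pairing x6 !inE; case: (lab x).1;
  rewrite eqxx ?orbT.
Qed.

Lemma count_piece_miss i s : emb i (s, 6) \notin p -> count (piece i) p <= 1.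
Proof.
move=> Ns; apply: (count_sub (L := [:: emb i (~~ s, 6)])) => x xp /andP[/eqP xi /eqP x6].
have E : x = emb i ((lab x).1, 6) by rewrite -{1}(emb_lab x) xi {1}[lab x]surjective_pairing x6.
rewrite E inE; case: (eqVneq (lab x).1 s) => [e|ne]; first by rewrite -e -E xp in Ns.
by case: (lab x).1 s ne {Ns E} => [] [].
Qed.

(* The pair of pieces excused by each end of the path.  The definitions are mirror
   images: when both ends lie in one gadget they excuse different pairs. *)
Definition exempt_head := if (lab h).2 == 6 then h.1 else if full h.1 then h.1 else ord_pred h.1.
Definition exempt_last := if (lab l).2 == 6 then l.1 else if full (ord_pred l.1) then ord_pred
  l.1 else l.1.

(** A piece that is an end of the path exempts its own pair, so a pair that is not full misses a
    piece. For a full pair, neither end lies in the two adjacent gadgets and [full_loop] applies. *)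
Lemma nonexempt i : i != exempt_head -> i != exempt_last ->
  [|| count (piece i) p <= 1, count (core i) p <= 10 | count (core (ordS i)) p <= 10].
Proof.
move=> ih il; apply/or3P.
case: (boolP (full i)) => [fi|]; last first.
  rewrite negb_forall => /existsP[s /nandP[Ns|/nandP[/negPn/eqP e|/negPn/eqP e]]].
  - by apply: Or31; apply: count_piece_miss Ns.
  - by move: ih; rewrite /exempt_head -e lab_emb // eqxx.
  - by move: il; rewrite /exempt_last -e lab_emb // eqxx.
have S6 k x : core k x -> x.1 = k /\ ((lab x).2 == 6) = false.
  by case/andP=> /eqP -> x6; split=> //; rewrite ltn_eqF.
have Sh : ~~ core i h.
  by apply/negP => /S6[e e6]; move: ih; rewrite /exempt_head e6 e fi eqxx.
have Sl' : ~~ core (ordS i) l.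
  by apply/negP => /S6[e e6]; move: il; rewrite /exempt_last e6 e ordSK fi eqxx.
(* If [l] lay in gadget [i] without exempting pair [i], the preceding pair would be full too, and
   parity would put [h] in gadget [i]. *)
have Sl : ~~ core i l.
  apply/negP => Sl; have [e e6] := S6 _ _ Sl; move: il; rewrite /exempt_last e6 e.
  case: ifP => [f0 _|]; last by rewrite eqxx.
  by move: Sh; rewrite (full_parity f0 fi) Sl.
have Sh' : ~~ core (ordS i) h.
  apply/negP => Sh'; have [e e6] := S6 _ _ Sh'; move: ih; rewrite /exempt_head e6 e.
  case: ifP => [f1 _|]; last by rewrite ordSK eqxx.
  have f0 : full (ord_pred (ordS i)) by rewrite ordSK.
  by move: Sl'; rewrite -(full_parity f0 f1) Sh'.
by case/orP: (full_loop fi Sh Sl Sh' Sl') => H; [apply: Or32 | apply: Or33].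
Qed.

(** Each of the at least [n] pairs that are not exempt is charged to a missed vertex. A gadget may
    be charged by the pairs on both of its sides, which its two missed vertices pay for. *)
Lemma size_path_bound : size p + n <= 14 * r.
Proof.
pose c i := count (core i) p; pose m i := count (piece i) p.
have sumS : \sum_i (c (ordS i) <= 10 : nat) = \sum_i (c i <= 10 : nat).
  by rewrite [RHS](reindex_inj (@ordS_inj _)).
have le_n : n <= \sum_i ((m i <= 1) + (c i <= 10) + (c (ordS i) <= 10)).
  pose E := [set exempt_head; exempt_last].
  have : n <= \sum_(i in ~: E) 1.
    rewrite sum1_card; have := cardsC E; rewrite card_ord => /eqP; rewrite -(eqn_add2l 0) => /eqP.
    have : #|E| <= 2 by rewrite cards2; case: eqP.
    lia.
  move/leq_trans; apply; rewrite [X in _ <= X](bigID (mem (~: E))) /=;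
    apply: leq_trans (leq_addr _ _).
  apply: leq_sum => i; rewrite !inE negb_or => /andP[ih il].
  by have /or3P[] := nonexempt ih il; rewrite -/(m i) -/(c i) -/(c (ordS i)) => ->; lia.
rewrite !big_split /= sumS in le_n.
have lem : \sum_i m i + \sum_i (m i <= 1 : nat) <= 2 * r.
  rewrite -big_split /=; have -> : 2 * r = \sum_(i < r) 2 by rewrite sum_nat_const card_ord mulnC.
  by apply: leq_sum => i _; have := count_piece i; rewrite -/(m i); lia.
have lec : \sum_i c i + (\sum_i (c i <= 10 : nat) + \sum_i (c i <= 10 : nat)) <= 12 * r.
  rewrite -!big_split /=; have -> : 12 * r = \sum_(i < r) 12 by rewrite sum_nat_const card_ord
    mulnC.
  by apply: leq_sum => i _; have := count_core i; rewrite -/(c i); lia.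
have -> : size p = \sum_i c i + \sum_i m i by rewrite size_sum big_split.
move: le_n lem lec; move: (\sum_i c i) (\sum_i m i) => C M.
move: (\sum_i (m i <= 1 : nat)) (\sum_i (c i <= 10 : nat)) => M1 C1 H1 H2 H3.
lia.
Qed.

End Path.
End Ring.

Arguments lab : simpl never.

(** * A long path *)

Section Long.
Variable n : nat.
Notation r := n.+2.
Notation vtx := (vtx n).
Notation edge := (@edge n).
Implicit Types (x y z : vtx) (t s : bool).

Definition vtx_at (k : nat) (a : label) : vtx := emb (inord k) a.

Definition flips t (a : seq label) : seq label := [seq (t (+) b.1, b.2) | b <- a].

(** Stays within positions 0 to 3, so that it is disjoint from [bounce] when both take place in the
    last gadget. *)
Definition turn : seq label :=
  [:: (false,0); (false,1); (false,2); (false,3); (true,3); (true,2); (true,1); (true,0)].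
Definition bounce : seq label :=
  [:: (false,6); (false,4); (false,5); (true,5); (true,4); (true,6)].
(** A hamiltonian path of the gadget between ports of opposite sides and levels, followed by a
    piece; the entry level thus alternates along the ring. *)
Definition pass : seq label :=
  [:: (false,0); (false,1); (false,2); (false,3); (false,4); (false,5);
      (true,5); (true,0); (true,1); (true,2); (true,3); (true,4); (true,6)].

(** After [m] passes, entered first at level [t], the path turns in the next gadget and ends on the
    piece of the preceding pair that was left out on the way in. *)
Fixpoint tail (k m : nat) t : seq vtx :=
  if m is m'.+1 then map (vtx_at k) (flips t pass) ++ tail k.+1 m' (~~ t)
  else rcons (map (vtx_at k) (flips t turn)) (vtx_at k.-1 (~~ t, 6)).

Lemma tail0 k t : tail k 0 t = rcons (map (vtx_at k) (flips t turn)) (vtx_at k.-1 (~~ t, 6)).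
Proof. by []. Qed.

Lemma tailS k m t : tail k m.+1 t = map (vtx_at k) (flips t pass) ++ tail k.+1 m (~~ t).
Proof. by []. Qed.

Arguments tail : simpl never.

(** The bounds are those under which [lab] inverts [emb], as [inord] sends larger positions to 0. *)
Definition ladj7 : rel label := fun a b => [&& ladj a b, a.2 < 7 & b.2 < 7].

Lemma at_unit k b : k < r -> (vtx_at k b).1 = k :> nat.
Proof. by move=> kr; rewrite inordK. Qed.

Lemma at_inj1 k k' a b : k < r -> k' < r -> vtx_at k a = vtx_at k' b -> k = k'.
Proof. by move=> kr kr' E; rewrite -(at_unit a kr) E at_unit. Qed.

Lemma lab_at k b : b.2 < 7 -> lab (vtx_at k b) = b.
Proof. by case: b => s j; apply: lab_emb. Qed.

Lemma edge_at k a b : ladj7 a b -> edge (vtx_at k a) (vtx_at k b).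
Proof.
case: a b => [s i] [t j] /and3P[adj i7 j7].
by apply/orP; left; rewrite eqxx !lab_emb.
Qed.

Lemma path_at k a c : path ladj7 a c -> path edge (vtx_at k a) (map (vtx_at k) c).
Proof. by rewrite path_map; apply: sub_path => b d; apply: edge_at. Qed.

Lemma link_at k s : k < n.+1 -> edge (vtx_at k (s, 6)) (vtx_at k.+1 (s, 0)).
Proof.
move=> kn; apply/orP; right; apply/orP; left; apply/and4P; split; rewrite ?lab_emb //=.
by apply/eqP/val_inj; rewrite /= !inordK ?modn_small //; lia.
Qed.

Lemma link_last s : edge (vtx_at n.+1 (s, 6)) (vtx_at 0 (s, 0)).
Proof.
apply/orP; right; apply/orP; left; apply/and4P; split; rewrite ?lab_emb //=.
by apply/eqP/val_inj; rewrite /= !inordK ?modnn //; lia.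
Qed.

Lemma size_tail k m t : size (tail k m t) = 13 * m + 9.
Proof.
by elim: m k t => [|m IH] k t //; rewrite tailS size_cat IH /=; lia.
Qed.

Lemma last_tail k m t x : k + m = n.+1 -> exists s, last x (tail k m t) = vtx_at n (s, 6).
Proof.
elim: m k t x => [|m IH] k t x km.
  by rewrite tail0 last_rcons; exists (~~ t); congr vtx_at; lia.
by rewrite tailS last_cat; apply: IH; lia.
Qed.

Lemma path_block x k a c : edge x (vtx_at k a) -> path ladj7 a c -> path edge x (map (vtx_at k)
  (a :: c)).
Proof. by move=> xa ac; apply/andP; split=> //; apply: path_at. Qed.

Lemma path_tail k m t : 0 < k -> k + m = n.+1 -> path edge (vtx_at k.-1 (t, 6)) (tail k m t).
Proof.
elim: m k t => [|m IH] [|k] t // _ km.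
  rewrite tail0 rcons_path; apply/andP; split.
    by apply: path_block; [rewrite addbF; apply: link_at; lia | case: t].
  have -> : last (vtx_at k.+1.-1 (t, 6)) (map (vtx_at k.+1) (flips t turn)) = vtx_at k.+1 (~~
    t, 0) by case: t.
  by rewrite edgeC; apply: link_at; lia.
rewrite tailS cat_path; apply/andP; split.
  by apply: path_block; [rewrite addbF; apply: link_at; lia | case: t].
have -> : last (vtx_at k.+1.-1 (t, 6)) (map (vtx_at k.+1) (flips t pass)) = vtx_at k.+2.-1 (~~
  t, 6) by case: t.
by apply: IH => //; lia.
Qed.

(** The exceptional vertex is the final piece in the case [m = 0]. The bound on positions separates
    the tail from [bounce] in the last gadget. *)
Lemma tail_unit k m t x : 0 < k -> k + m = n.+1 -> x \in tail k m t ->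
  [/\ (k <= x.1) || (x == vtx_at k.-1 (~~ t, 6)) & (x.1 == n.+1 :> nat) ==> ((lab x).2 < 4)].
Proof.
elim: m k t => [|m IH] [|k] t // _ km.
  rewrite tail0 mem_rcons inE => /orP[/eqP ->|/mapP[b bt ->]].
    have kn : (k == n.+1) = false by rewrite ltn_eqF //; lia.
    by rewrite eqxx orbT at_unit ?kn //; lia.
  have {bt}b4 : b.2 < 4.
    by move: bt; case: t; rewrite !inE; do 7?[case/orP => [/eqP ->//|]]; move/eqP ->.
  have kr : k.+1 < r by lia.
  have b7 : b.2 < 7 by apply: leq_trans b4 _.
  by rewrite at_unit // (lab_at _ b7) leqnn; split=> //; apply/implyP.
rewrite tailS mem_cat => /orP[/mapP[b _ ->]|].
  have kr : k.+1 < r by lia.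
  have kn : (k.+1 == n.+1) = false by rewrite ltn_eqF //; lia.
  by rewrite at_unit // kn ?leqnn.
case/IH => // [|/orP[lt|/eqP ->] H]; first by lia.
  by split=> //; rewrite (ltnW lt).
have kr : k.+1 < r by lia.
have kn : (k.+1 == n.+1) = false by rewrite ltn_eqF //; lia.
by rewrite at_unit // kn leqnn.
Qed.

Lemma at_inj k : {in [pred a : label | a.2 < 7] &, injective (vtx_at k)}.
Proof. by move=> [s i] [t j]; rewrite !inE /= => i7 j7 /(congr1 (@lab n)); rewrite !lab_emb. Qed.

Lemma uniq_at k a : all [pred a : label | a.2 < 7] a -> uniq a -> uniq (map (vtx_at k) a).
Proof. by move=> /allP H U; rewrite map_inj_in_uniq // => b c /H b7 /H c7; apply: at_inj. Qed.

Lemma uniq_tail k m t : 0 < k -> k + m = n.+1 -> uniq (tail k m t).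
Proof.
elim: m k t => [|m IH] [|k] t // _ km.
  rewrite tail0 rcons_uniq uniq_at ?andbT; [|by case: t|by case: t].
  by apply/negP => /mapP[b _ /at_inj1]; lia.
rewrite tailS cat_uniq uniq_at; [|by case: t|by case: t].
rewrite IH //=; last by lia.
rewrite andbT; apply/hasPn => x xt; have km' : k.+2 + m = n.+1 by lia.
have [/orP[lt|/eqP Ex] _] := tail_unit (ltn0Sn _) km' xt; apply/negP => xb;
  have /mapP[b bt E] : x \in map (vtx_at k.+1) (flips t pass) := xb.
  by move: lt; rewrite E at_unit ?ltnn //; lia.
have b7 : b.2 < 7.
  by move: bt; case: (t); rewrite !inE; do 12?[case/orP => [/eqP ->//|]]; move/eqP ->.
(* The final piece could only be the one of level [t], whereas this pass takes the piece of level
   [~~ t]. *)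
move: Ex; rewrite E negbK => /at_inj; rewrite !inE b7 => /(_ isT isT) Eb.
by move: bt; rewrite Eb; case: (t).
Qed.

Definition long_path c d t : seq vtx :=
  map (vtx_at 0) c ++ map (vtx_at n.+1) bounce ++ map (vtx_at 0) (rcons d (t, 6)) ++ tail 1 n t.

(** The defaults of [last] and of the second [head] are the wrong ports, so empty lists are
    rejected. The last three conditions say that [c] and [d] partition the gadget. *)
Definition long_data (c d : seq label) t : bool :=
  [&& path ladj7 (head (false, 0) c) (behead c), last (true, 0) c == (false, 0),
      head (false, 0) d == (true, 0), path ladj7 (true, 0) (behead d ++ [:: (t, 6)]),
      uniq (c ++ d), all (fun a : label => a.2 < 6) (c ++ d) & size (c ++ d) == 12].

Lemma long_pathP c d t : long_data c d t ->
  [/\ is_gpath edge (long_path c d t), size (long_path c d t) = 13 * r + 2,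
      head (vtx_at 0 (false, 0)) (long_path c d t) = vtx_at 0 (head (false, 0) c) &
      exists s, last (vtx_at 0 (false, 0)) (long_path c d t) = vtx_at n (s, 6)].
Proof.
case/and5P => pc lc hd pd /and3P[U A6 /eqP sz].
have A7 : all (fun a : label => a.2 < 7) (c ++ d) by apply: sub_all A6 => a; apply: ltnW.
case: c lc pc U A6 A7 sz => [|a c] //= lc pc U A6 A7 sz.
case: d hd pd U A6 A7 sz => [|b d] //= /eqP Eb; subst b => pd U A6 A7 sz.
have H6 b : b \in (a :: c) ++ (true, 0) :: d -> b.2 < 6.
  by apply: (allP (A6 : all (fun a : label => a.2 < 6) ((a :: c) ++ (true, 0) :: d))).
have H7 b : b \in (a :: c) ++ (true, 0) :: d -> b.2 < 7 by move/H6/ltnW.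
have last_d : last (true, 0) (d ++ [:: (t, 6)]) = (t, 6) by rewrite last_cat.
have [s ls] := @last_tail 1 n t (vtx_at 0 (t, 6)) erefl.
have El : last (vtx_at 0 (false, 0)) (long_path (a :: c) ((true, 0) :: d) t) = last (vtx_at 0
  (t, 6)) (tail 1 n t).
  by rewrite /long_path !last_cat map_rcons last_rcons.
have pL : path edge (vtx_at 0 a) (behead (long_path (a :: c) ((true, 0) :: d) t)).
  rewrite -[behead _]/(map (vtx_at 0) c ++ (map (vtx_at n.+1) bounce ++
    (map (vtx_at 0) (rcons ((true, 0) :: d) (t, 6)) ++ tail 1 n t))).
  rewrite cat_path path_at // last_map (eqP lc) cat_path.
  have -> : path edge (vtx_at 0 (false, 0)) (map (vtx_at n.+1) bounce).
    by apply: path_block => //; rewrite edgeC link_last.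
  rewrite cat_path.
  have -> : last (vtx_at 0 (false, 0)) (map (vtx_at n.+1) bounce) = vtx_at n.+1 (true, 6) by [].
  rewrite rcons_cons -cats1 path_block ?link_last // map_cons last_cons last_map last_d.
  by apply: (path_tail (k := 1)).
have uL : uniq (long_path (a :: c) ((true, 0) :: d) t).
  (* Both visits to gadget 0 are brought together, so that disjointness can be decided gadget by
     gadget. *)
  have Hperm : perm_eq (long_path (a :: c) ((true, 0) :: d) t)
     (map (vtx_at 0) ((t, 6) :: (a :: c) ++ (true, 0) :: d) ++ map (vtx_at n.+1) bounce ++ tail
       1 n t).
    apply/permP => P; rewrite /long_path -cats1 -(cat1s (t, 6) (_ ++ _)) !map_cat !count_cat.
    lia.
  rewrite (perm_uniq Hperm) cat_uniq; apply/and3P; split.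
  - apply: uniq_at; first by apply/andP.
    by rewrite cons_uniq; apply/andP; split; last exact: U; apply/negP => /H6; rewrite ltnn.
  - apply/hasPn => x; rewrite mem_cat => H; apply/negP => x0.
    have /mapP[b bt E] : x \in map (vtx_at 0) ((t, 6) :: (a :: c) ++ (true, 0) :: d) := x0.
    move: H; rewrite E => /orP[/mapP[b' _ /at_inj1]|xt]; first by lia.
    have [/orP[lt|/eqP Ex] _] := tail_unit (ltn0Sn _) (erefl : 1 + n = n.+1) xt.
      by move: lt; rewrite at_unit.
    have b7 : b.2 < 7 by move: bt; rewrite inE => /orP[/eqP ->|/H7].
    (* Only the final piece of the tail could lie in gadget 0; its level is [~~ t], while the first
       block has only the piece of level [t]. *)
    move: Ex => /at_inj; rewrite !inE b7 => /(_ isT isT) Eb.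
    move: bt; rewrite Eb inE xpair_eqE; case: (t) => /= /H6; by rewrite ltnn.
  rewrite cat_uniq uniq_at // uniq_tail // andbT.
  apply/hasPn => x xt; apply/negP => xb.
  have /mapP[b bt E] : x \in map (vtx_at n.+1) bounce := xb.
  have [_] := tail_unit (ltn0Sn _) (erefl : 1 + n = n.+1) xt.
  rewrite E at_unit // eqxx implyTb.
  have b7 : b.2 < 7 by move: bt; rewrite !inE; do 5?[case/orP => [/eqP ->//|]]; move/eqP ->.
  rewrite (lab_at _ b7); move: bt; rewrite !inE; do 5?[case/orP => [/eqP ->//|]]; by move/eqP ->.
split.
- exact/andP.
- move: sz; rewrite /long_path !size_cat /= size_map size_cat size_map size_rcons size_tail; lia.
- by [].
- by exists s; apply: etrans El ls.
Qed.
End Long.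

(** * Automorphisms *)

Lemma has_path_from_seq (T : finType) (e : rel T) (v : T) (p : seq T) :
  is_gpath e (v :: p) -> has_path_from e v (size p).+1.
Proof. by move=> H; apply/existsP; exists (in_tuple (v :: p)); rewrite H eqxx. Qed.

Lemma seq_has_path_from (T : finType) (e : rel T) (v : T) (k : nat) :
  has_path_from e v k -> exists2 p, is_gpath e (v :: p) & (size p).+1 = k.
Proof.
case/existsP => -[[|x p] sz] //= /andP[H /eqP xv]; exists p; first by rewrite -xv.
exact/eqP.
Qed.

Lemma has_path_from_map (T : finType) (e : rel T) (f : T -> T) (v : T) (k : nat) :
  injective f -> {homo f : x y / e x y} -> has_path_from e v k -> has_path_from e (f v) k.
Proof.
move=> fI fe /seq_has_path_from[p /andP[pth U] <-]; rewrite -(size_map f).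
apply: has_path_from_seq; apply/andP; split; first exact: homo_path pth.
by rewrite -map_cons map_inj_uniq.
Qed.

Lemma is_gpath_rev (T : finType) (e : rel T) (v : T) (p : seq T) : symmetric e ->
  is_gpath e (v :: p) -> is_gpath e (last v p :: rev (belast v p)).
Proof.
move=> eC /andP[pth U]; apply/andP; split.
  by rewrite rev_path (eq_path (e' := e)) // => a b; rewrite eC.
by rewrite -rev_rcons -lastI rev_uniq.
Qed.

Section Automorphisms.
Variable n : nat.
Notation r := n.+2.
Notation vtx := (vtx n).
Notation edge := (@edge n).
Implicit Types (x y z : vtx) (i : 'I_r) (s : bool).

Definition rotate x : vtx := (ordS x.1, x.2).

Lemma rotate_inj : injective rotate.
Proof.
move=> [i a] [j b] E; have /= /ordS_inj -> := congr1 fst E.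
by have /= -> := congr1 snd E.
Qed.

Lemma rotate_edge : {homo rotate : x y / edge x y}.
Proof.
move=> x y /or3P[/andP[/eqP xy H]|/and4P[/eqP yx H1 H2 H3]|/and4P[/eqP xy H1 H2 H3]]; apply/or3P.
- by apply: Or31; rewrite /= xy eqxx.
- by apply: Or32; apply/and4P; split; rewrite //= yx.
- by apply: Or33; apply/and4P; split; rewrite //= xy.
Qed.

Definition flip x : vtx := (x.1, (~~ x.2.1, x.2.2)).

Lemma flip_inj : injective flip.
Proof. by move=> [i [a j]] [i' [b j']] [-> /negb_inj -> ->]. Qed.

Lemma ladj_flip (a b : label) : ladj (~~ a.1, a.2) (~~ b.1, b.2) = ladj a b.
Proof. by rewrite /ladj /= (inj_eq negb_inj). Qed.

Lemma flip_edge : {homo flip : x y / edge x y}.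
Proof.
move=> x y /or3P[/andP[xy H]|/and4P[yx H1 H2 H3]|/and4P[xy H1 H2 H3]]; apply/or3P.
- by apply: Or31; rewrite /= xy -[ladj _ _]/(ladj (~~ (lab x).1, (lab x).2) (~~ (lab y).1, (lab
  y).2)) ladj_flip.
- by apply: Or32; apply/and4P; split; rewrite //= (eqP H1).
- by apply: Or33; apply/and4P; split; rewrite //= (eqP H1).
Qed.

(** Reverses the ring and exchanges left and right, fixing positions 2 and 5 of a gadget. The piece
    between [i] and [ordS i] comes to follow the image of [ordS i], hence the shift. *)
Definition reflect x : vtx :=
  emb (rev_ord (if (lab x).2 == 6 then ordS x.1 else x.1))
      ((lab x).1, if (lab x).2 <= 4 then 4 - (lab x).2 else (lab x).2).

Lemma ordS_rev i : ordS (rev_ord (ordS i)) = rev_ord i.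
Proof.
apply: val_inj => /=; have := ltn_ord i; rewrite ltnS leq_eqVlt => /orP[/eqP ->|lt].
  by rewrite modnn subn1 modnn subnn.
by rewrite (modn_small (m := i.+1)) // modn_small; lia.
Qed.

Lemma lab_reflect x : lab (reflect x) = ((lab x).1, if (lab x).2 <= 4 then 4 - (lab x).2 else
  (lab x).2).
Proof. by rewrite lab_emb //; have := lab_lt7 x; case: ifP; lia. Qed.

Lemma reflect1 x : (reflect x).1 = rev_ord (if (lab x).2 == 6 then ordS x.1 else x.1).
Proof. by []. Qed.

Lemma reflectK : involutive reflect.
Proof.
move=> x; apply: vtx_eq.
  rewrite !reflect1 lab_reflect; have := lab_lt7 x.
  case: (lab x) => s j /= j7; case: (eqVneq j 6) => [->|j6] /=;
    first by rewrite ordS_rev !rev_ordK.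
  case: (leqP j 4) => j4; last by rewrite (negPf j6) rev_ordK.
  by rewrite ltn_eqF ?rev_ordK //; lia.
rewrite !lab_reflect; case: (lab x) => s j /=.
by case: (leqP j 4) => H; rewrite ?leq_subr ?subKn // leqNgt H.
Qed.

Lemma reflect_edge : {homo reflect : x y / edge x y}.
Proof.
have H6 (x y : vtx) : (lab x).2 = 6 -> (x.1 == y.1) && ladj (lab x) (lab y) -> link (reflect x)
  (reflect y).
  move=> x6 /andP[/eqP xy]; rewrite [lab x]surjective_pairing x6 ladjC => /ladj_exit ly.
  apply/and4P; split; rewrite ?reflect1 ?lab_reflect ?ly ?x6 //=.
  - by rewrite ordS_rev xy.
  - by rewrite -[X in _ == X]/((lab y).1) ly.
have Hl (x y : vtx) : link x y -> (reflect x).1 = (reflect y).1 /\ ladj (lab (reflect x)) (lab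
  (reflect y)).
  case/and4P => /eqP yx /eqP s1 /eqP x6 /eqP y0; rewrite !lab_reflect x6 y0; split.
    by rewrite !reflect1 x6 y0 /= yx.
  by rewrite /ladj /= s1 eqxx.
move=> x y /or3P[H|H|H]; apply/or3P.
- case: (eqVneq (lab x).2 6) => x6; first by apply: Or32; apply: H6.
  case: (eqVneq (lab y).2 6) => y6.
    by apply: Or33; apply: H6; rewrite // eq_sym ladjC.
  apply: Or31; case/andP: H => /eqP xy adj;
    rewrite !reflect1 (negPf x6) (negPf y6) xy eqxx !lab_reflect andTb.
  have := lab_lt7 x; have := lab_lt7 y; case: (lab x) (lab y) adj x6 y6 => s i [t j] /=.
  by case: s; case: t; do 7?[case: i => [|i] //]; do 7?[case: j => [|j] //].
- by have [-> ->] := Hl _ _ H; apply: Or31; rewrite eqxx.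
- by have [-> adj] := Hl _ _ H; apply: Or31; rewrite eqxx ladjC adj.
Qed.

Lemma iter_ordS k i : val (iter k (@ordS r) i) = (i + k) %% r.
Proof.
elim: k => [|k IH] /=; first by rewrite addn0 modn_small.
by move: IH => /= ->; rewrite -addn1 modnDml addn1 addnS.
Qed.

(** Equals [14 * r - n], the bound of [size_path_bound]. *)
Definition detour_order := 13 * r + 2.

Lemma rotate_all i j (l : label) k : has_path_from edge (emb i l) k -> has_path_from edge (emb
  j l) k.
Proof.
move=> H; have <- : iter (r - i + j) rotate (emb i l) = emb j l.
  have -> m : iter m rotate (emb i l) = emb (iter m (@ordS r) i) l by elim: m => //= m ->.
  congr emb; apply: val_inj; rewrite iter_ordS addnA subnKC ?(ltnW (ltn_ord i)) //.
  by rewrite modnDl modn_small.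
elim: (r - i + j) => [|m IH]; first exact: H.
exact: has_path_from_map rotate_inj rotate_edge IH.
Qed.

(* For each entry [(c, d, t)], the paths [c] and [d] partition a gadget: [c] leads to the
   left port of level [false], [d] from the other left port to the right port of level
   [t].  The lists were found by computer search. *)
Definition starts : seq (seq label * seq label * bool) :=
 [:: ([:: (false,0)], [:: (true,0);(true,5);(false,5);(false,4);(false,3);(false,2);(false,1);(true,1);(true,2);(true,3);(true,4)], true)
   ;
     ([:: (false,2);(false,1);(false,0)], [::
       (true,0);(true,1);(true,2);(true,3);(false,3);(false,4);(false,5);(true,5);(true,4)],
       true);
     ([:: (false,3);(false,2);(false,1);(false,0)], [::
       (true,0);(true,1);(true,2);(true,3);(true,4);(true,5);(false,5);(false,4)], false);
     ([:: (false,5);(false,0)], [:: (true,0);(true,5);(true,4);(true,3);(true,2);(true,1);(false,1);(false,2);(false,3);(false,4)], false)]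
       .

Lemma starts_data c d t : (c, d, t) \in starts -> long_data c d t.
Proof. by rewrite !inE => /or4P[] /eqP[-> -> ->]. Qed.

Lemma long_from v : has_path_from edge v detour_order.
Proof.
have H0 i c d t : (c, d, t) \in starts -> has_path_from edge (emb i (head (false, 0) c))
  detour_order.
  move=> /starts_data /(long_pathP n)[]; case: (long_path n c d t) => [|x p] //= gp sz hd _.
  by apply: (@rotate_all (inord 0)); rewrite -[emb _ _]hd -[detour_order]sz;
    apply: has_path_from_seq.
have Hflip (x : vtx) : has_path_from edge x detour_order -> has_path_from edge (flip x)
  detour_order.
  exact: has_path_from_map flip_inj flip_edge.
have Hrefl (x : vtx) : has_path_from edge x detour_order -> has_path_from edge (reflect x)
  detour_order.
  exact: has_path_from_map (inv_inj reflectK) reflect_edge.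
have Hs i (l : label) : l.2 < 7 -> has_path_from edge (emb i l) detour_order -> forall s,
  has_path_from edge (emb i (s, l.2)) detour_order.
  case: l => t j /= j7 H s; case: (eqVneq t s) => [<-//|ts].
  have -> : emb i (s, j) = flip (emb i (t, j)) by rewrite /flip /emb /=;
    case: (t) (s) ts => [] [].
  exact: Hflip.
(* A long path ends on a piece, so its reversal starts there. *)
have H6 i s : has_path_from edge (emb i (s, 6)) detour_order.
  have [] := long_pathP n (starts_data (mem_head _ _)).
  case: (long_path n _ _ _) => [|x p] // gp sz hd [t El].
  apply: (Hs _ (t, 6)) => //; apply: (@rotate_all (inord n));
    rewrite -[emb _ _]El /= -[detour_order]sz.
  have := has_path_from_seq (is_gpath_rev (@edgeC n) gp).
  by rewrite size_rev size_belast.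
have Hr i s j : j <= 4 -> has_path_from edge (emb (rev_ord i) (s, j)) detour_order ->
  has_path_from edge (emb i (s, 4 - j)) detour_order.
  move=> j4 /Hrefl; congr (has_path_from _ _ _).
  by rewrite /reflect lab_emb; [rewrite /= j4 ltn_eqF ?rev_ordK //; lia | lia].
rewrite -(emb_lab v); have := lab_lt7 v; case: (lab v) => s j /=.
have A k : k \in [:: 0; 2; 3; 5] -> forall i t, has_path_from edge (emb i (t, k)) detour_order.
  rewrite !inE => /or4P[]/eqP -> i t.
  - by apply: (Hs i (false, 0)) => //; apply: (H0 i _ _ _ (mem_nth ([::], [::], true) (isT : 0
    < size starts))).
  - by apply: (Hs i (false, 2)) => //; apply: (H0 i _ _ _ (mem_nth ([::], [::], true) (isT : 1
    < size starts))).
  - by apply: (Hs i (false, 3)) => //; apply: (H0 i _ _ _ (mem_nth ([::], [::], true) (isT : 2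
    < size starts))).
  - by apply: (Hs i (false, 5)) => //; apply: (H0 i _ _ _ (mem_nth ([::], [::], true) (isT : 3
    < size starts))).
(* Position 6 is closed by [H6]; positions 1 and 4 remain, the mirror images of 3 and 0. *)
do 7?[case: j => [|j] //] => _; try exact: A.
- by apply: (@Hr _ _ 3) => //; apply: A.
- by apply: (@Hr _ _ 0) => //; apply: A.

Qed.

End Automorphisms.

(** * The detour order *)

Section Final.
Variable n : nat.
Notation r := n.+2.
Notation vtx := (vtx n).
Notation edge := (@edge n).
Implicit Types (x y z : vtx) (i : 'I_r) (s : bool).

Lemma card_vtx : #|vtx| = 14 * r.
Proof. by rewrite !card_prod card_bool !card_ord mulnC. Qed.

Lemma gpath_bound (p : seq vtx) : is_gpath edge p -> size p <= detour_order n.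
Proof. by case: p => // h q /andP[pth U]; have := size_path_bound pth U; rewrite /detour_order;
  lia. Qed.

Lemma detour_order_lt : detour_order n < #|vtx|.+1.
Proof. by rewrite card_vtx /detour_order; lia. Qed.

Lemma tau_vE (v : vtx) : tau_v edge v = detour_order n.
Proof.
apply/eqP; rewrite eqn_leq; apply/andP; split.
  by apply/bigmax_leqP => k /existsP[t /andP[/gpath_bound]]; rewrite size_tuple.
by apply: (bigmax_sup (Ordinal detour_order_lt)) => //; apply: long_from.
Qed.

Lemma tau_G_le : tau_G edge <= detour_order n.
Proof. by apply/bigmax_leqP => k /existsP[t /gpath_bound]; rewrite size_tuple. Qed.

(** * Simplicity, bipartiteness and connectedness *)

Lemma ladj_irr : irreflexive ladj.
Proof.
move=> [s j]; rewrite /ladj eqxx orbb /hexn /=.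
by do 5?[case: j => [|j] //].
Qed.

Lemma edge_simple : simple_graph edge.
Proof.
split; first exact: edgeC.
move=> x; rewrite /edge ladj_irr andbF /= orbb; apply/negP => /and4P[_ _ /eqP ->].
by [].
Qed.

(** A piece is adjacent to two even positions of its level, so it is coloured like an odd one. The
    colouring is the same in every gadget, whatever the length of the ring. *)
Definition label_color (a : label) : bool := a.1 (+) (odd a.2 || (a.2 == 6)).

Lemma ladj_color (a b : label) : ladj a b -> label_color a != label_color b.
Proof.
case: a b => [s i] [t j]; rewrite /ladj /hexn /label_color /=; case: eqP => [->|st].
  by rewrite !inE !xpair_eqE; do 7?[case: i => [|i] //]; do 7?[case: j => [|j] //];
    case: t; rewrite ?andbF.
by case/andP=> /eqP -> ->; case: s t st => [] [].
Qed.

Lemma edge_bipartite : bipartite edge.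
Proof.
exists (fun x => label_color (lab x)).
have Hl x y : link x y -> label_color (lab x) != label_color (lab y).
  case/and4P => _ /eqP s1 /eqP x6 /eqP y0; rewrite /label_color x6 y0 /=.
  by rewrite s1; case: (y.2.1).
move=> x y /or3P[/andP[_ /ladj_color]|/Hl|/Hl] //.
by rewrite eq_sym.
Qed.

Lemma connect_label i (a b : label) :
  ladj a b -> a.2 < 7 -> b.2 < 7 -> connect edge (emb i a) (emb i b).
Proof.
case: a b => [s j] [t k] H j7 k7; apply: connect1; apply/orP; left.
by rewrite eqxx !lab_emb.
Qed.

Lemma connect_base (v : vtx) : connect edge v (emb v.1 (false, 0)).
Proof.
pose i := v.1; rewrite -/i.
have C1 s : connect edge (emb i (s, 1)) (emb i (false, 0)).
  have H : connect edge (emb i (false, 1)) (emb i (false, 0)) by exact: connect_label.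
  by case: s => //; apply: connect_trans H; exact: connect_label.
rewrite -{1}(emb_lab v) -/i; have := lab_lt7 v; case: (lab v) => s j.
have C2 : connect edge (emb i (s, 2)) (emb i (false, 0)) by apply: connect_trans (C1 s);
  apply: connect_label; rewrite // /ladj eqxx.
have C3 : connect edge (emb i (s, 3)) (emb i (false, 0)) by apply: connect_trans C2;
  apply: connect_label; rewrite // /ladj eqxx.
have C4 : connect edge (emb i (s, 4)) (emb i (false, 0)) by apply: connect_trans C3;
  apply: connect_label; rewrite // /ladj eqxx.
have C0 : connect edge (emb i (s, 0)) (emb i (false, 0)) by apply: connect_trans (C1 s);
  apply: connect_label; rewrite // /ladj eqxx.
have C5 : connect edge (emb i (s, 5)) (emb i (false, 0)) by apply: connect_trans C4;
  apply: connect_label; rewrite // /ladj eqxx.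
have C6 : connect edge (emb i (s, 6)) (emb i (false, 0)) by apply: connect_trans C4;
  apply: connect_label; rewrite // /ladj eqxx.
rewrite /=; case: j => [|[|[|[|[|[|[|j]]]]]]] // _; exact: C1.
Qed.

Lemma connect_next i : connect edge (emb i (false, 0)) (emb (ordS i) (false, 0)).
Proof.
have sym : connect_sym edge by apply: sym_connect_sym; apply: edgeC.
have H := connect_base (emb i (false, 6)); rewrite sym in H; apply: connect_trans H _.
by apply: connect1; apply/orP; right; apply/orP; left; apply/and4P; split; rewrite ?lab_emb.
Qed.

Lemma edge_connected : connected_graph edge.
Proof.
split=> [|x y]; first by rewrite card_vtx.
have sym : connect_sym edge by apply: sym_connect_sym; apply: edgeC.
apply: connect_trans (connect_base x) _; rewrite sym.
apply: connect_trans (connect_base y) _.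
have <- : iter (r - y.1 + x.1) (@ordS r) y.1 = x.1.
  by apply: val_inj; rewrite iter_ordS addnA subnKC ?modnDl ?modn_small // ltnW.
elim: (r - y.1 + x.1) => [|m IH]; first exact: connect0.
exact: connect_trans IH (connect_next _).
Qed.

End Final.

Theorem theorem2p25 : forall d : nat, 1 <= d ->
  exists (T : finType) (e : rel T),
    simple_graph e /\ bipartite e /\ connected_graph e /\
    nontraceable e /\ detour_graph e /\ d <= detour_deficiency e.
Proof.
move=> d d1; exists (vtx d), (@edge d); split; first exact: edge_simple.
split; first exact: edge_bipartite.
split; first exact: edge_connected.
split.
  (* With [d + 2] gadgets, [14 * (d + 2)] exceeds the detour order by exactly [d], which is
     positive. *)
  by apply/existsP => -[t /gpath_bound]; rewrite size_tuple card_vtx /detour_order; lia.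
split; first by move=> u v; rewrite !tau_vE.
by rewrite /detour_deficiency card_vtx; have := tau_G_le d; rewrite /detour_order; lia.
Qed.
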